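(* If $\theta\ge0$ and $-1<\rho\le0$, then $\mathrm{effar}(1;\rho,\theta)\ge\mathrm{effar}(k;\rho,\theta)$ for all integers $k\ge2$.
   Context: For $\rho\in(-1,1)$, $\theta\ge0$ and integer $k\ge1$, define $$\mathrm{effar}(k;\rho,\theta)=\frac{1+\theta}{k+\theta}\cdot\frac{1+\rho}{1-\rho}\cdot\frac{1-\rho^k}{1+\rho^k}.$$ (This is the efficiency of thinning a Markov chain sample by factor $k$ relative to no thinning when the autocorrelations are $\rho_\ell=\rho^\ell$, advancing the chain costs $1$ and evaluating the function costs $\theta$.) *)

(* Defs.v *)
From mathcomp Require Import all_boot all_order all_algebra.

Set Implicit Arguments.
Unset Strict Implicit.
Unset Printing Implicit Defensive.

Import Order.TTheory GRing.Theory Num.Theory.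
Local Open Scope ring_scope.

(* Efficiency of thinning by a factor k, relative to no thinning, when the
   lag-l autocorrelation is rho ^+ l, advancing the chain costs 1 and
   evaluating the function costs theta. It is meaningful for -1 < rho < 1,
   0 <= theta and 1 <= k, where all three denominators are positive. *)
Definition effar (R : realFieldType) (k : nat) (rho theta : R) : R :=
  (1 + theta) / (k%:R + theta) * ((1 + rho) / (1 - rho)) *
  ((1 - rho ^+ k) / (1 + rho ^+ k)).

(* Main.v *)
(* With no thinning the efficiency is 1. For k >= 2 the cost ratio
   (1 + theta) / (k + theta) is at most 1, and the product of the remaining two
   factors is at most 1 exactly when rho <= rho ^+ k, which holds for
   -1 < rho <= 0 because |rho ^+ k| <= |rho| = - rho. *)
Require Import Defs.
From mathcomp Require Import all_boot all_order all_algebra.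
From mathcomp Require Import ring lra.

Set Implicit Arguments.
Unset Strict Implicit.
Unset Printing Implicit Defensive.

Import Order.TTheory GRing.Theory Num.Theory.
Local Open Scope ring_scope.

Lemma ler_norm_expr (R : realDomainType) (x : R) (k : nat) :
  `|x| <= 1 -> (0 < k)%N -> `|x ^+ k| <= `|x|.
Proof.
case: k => // k x_le1 _.
by rewrite normrX exprS ler_piMr // exprn_ile1.
Qed.

Lemma effar1 (R : realFieldType) (rho theta : R) :
  0 <= theta -> -1 < rho -> rho < 1 -> effar 1 rho theta = 1.
Proof.
move=> theta_ge0 rho_gtN1 rho_lt1; rewrite /effar expr1.
by field; rewrite !gt_eqF //=; lra.
Qed.

Theorem proposition1 (R : realFieldType) (rho theta : R)
    (theta_ge0 : 0 <= theta) (rho_gtN1 : -1 < rho) (rho_le0 : rho <= 0) :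
  forall k : nat, (2 <= k)%N -> effar 1 rho theta >= effar k rho theta.
Proof.
move=> k k_ge2; rewrite effar1 //; last by lra.
have k_gt0 : (0 < k)%N by apply: leq_trans k_ge2.
have norm_rho : `|rho| = - rho by rewrite ler0_norm.
have : `|rho ^+ k| <= - rho.
  by rewrite -norm_rho; apply: ler_norm_expr => //; rewrite norm_rho; lra.
(* Since [-1 < rho], the lower bound makes [1 + rho ^+ k] positive and the upper one makes
   [1 - rho ^+ k] positive. *)
rewrite ler_norml opprK => /andP[rho_le_rhok rhok_le].
have kR_ge1 : 1 <= k%:R :> R by rewrite ler1n.
(* The last two factors stay together: for odd [k] and [rho < 0] the third alone exceeds 1. *)
rewrite /effar -mulrA; apply: mulr_ile1.
- by apply: divr_ge0; lra.
- by apply: mulr_ge0; apply: divr_ge0; lra.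
- by rewrite ler_pdivrMr; lra.
- rewrite mulf_div ler_pdivrMr; last by apply: mulr_gt0; lra.
  (* Once expanded, the terms [rho * rho ^+ k] cancel, leaving [2 * rho <= 2 * rho ^+ k]. *)
  by rewrite mul1r; nra.
Qed.
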